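(* Let $\rho>0$. Consider the hierarchical optimization problem over a tree network with $D$ levels, written in layered form as $\min \sum_{d=1}^D f_d(x_d)$ subject to $A_dx_d+B_dx_{d+1}=c_d$ for $d=1,\dots,D-1$, where $f_d,A_d,B_d,c_d$ are built from the tree as described in the context. Assume that the problem has a strictly feasible point (Slater's condition) and admits an optimal solution. Suppose that $\|B_d\|_2\ne 0$ for all $d\in\{1,\dots,D-1\}$; that $f_1,\dots,f_D$ are differentiable and strongly convex with moduli $\alpha_d>0$, i.e. $f_d(z)-f_d(z')\ge\nabla f_d(z')^\top(z-z')+\alpha_d\|z-z'\|_2^2$ for all $z,z'\in\mathrm{Dom}(f_d)$; and that $\nabla f_2,\dots,\nabla f_D$ are Lipschitz continuous with constants $l_d$, i.e. $\|\nabla f_d(z)-\nabla f_d(z')\|_2\le l_d\|z-z'\|_2$ for all $z,z'\in\mathrm{Dom}(f_d)$. Choose $t\in(0,1)$ and $0<\sigma<\bar\sigma=\min_{d\in\{1,\dots,D-1\}}\left\{\frac{2t\alpha_{d+1}}{\|B_d\|_2^2}\right\}$. Let $\Xi,\Theta$ be the symmetric $4s\times4s$ matrices defined in the context (depending on $t,\sigma,\rho,\alpha_d,l_d,A_d,B_d$). Assume that the semidefinite program $$\gamma^\star=\max_{\gamma>0}\ \gamma\quad\text{s.t.}\quad \Xi-\gamma\Theta\succeq0$$ is feasible and let $\gamma^\star>0$ be its optimal value. Let $\{([x_d^k]_{d=1}^D,[y_d^k]_{d=1}^{D-1})\}_k$ be generated by the hADMM algorithm with penalty parameter $\rho$, let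 $([x_d^\star]_{d=1}^D,[y_d^\star]_{d=1}^{D-1})$ be a KKT point of the problem, and define $$\hat V^k=\sum_{d=1}^{D-1}\Big(\frac1\rho\|y_d^k-y_d^\star\|_2^2+(\rho+\sigma)\|B_d(x_{d+1}^k-x_{d+1}^\star)\|_2^2\Big).$$ Then, for all $k\ge 0$, $$(1+\gamma^\star)\hat V^{k+1}\le\hat V^k .$$ Moreover, the sequence $\{[x_d^k]_{d=1}^D\}_k$ converges linearly to the unique minimizer $[x_d^\star]_{d=1}^D$: there exists a positive constant $C$ (independent of $k$) such that for all $k\ge0$ $$\sum_{d=1}^D\|x_d^{k+1}-x_d^\star\|_2\le C\Big(\frac{1}{\sqrt{1+\gamma^\star}}\Big)^k .$$
   Context: **Tree problem.** A rooted tree has levels $d=1,\dots,D$ ($D\ge 2$); node $(d,i)$ is the $i$-th node at level $d$, and $(1,1)$ is the only node at level 1 (the root). Each non-root node at level $d+1$ has exactly one parent, at level $d$. $\mathcal C_{d,i}$ is the set of indices $j$ such that $(d+1,j)$ is a child of $(d,i)$; $\mathcal P_d$ is the index set of nodes at level $d$ with at least one child (parents) and $\mathcal L_d$ the index set of nodes at level $d$ with no child (leaves). Node $(d,i)$ has a variable $x_{d,i}\in\mathbb R^{n_{d,i}}$ and a finite-valued convex cost $f_{d,i}:\mathbb R^{n_{d,i}}\to\mathbb R$. The hierarchical optimization problem minimizes $\sum_{d=1}^D\sum_{i\in\mathcal P_d\cup\mathcal L_d}f_{d,i}(x_{d,i})$ subject to $A_{d,ij}x_{d,i}+B_{d,ij}x_{d+1,j}=c_{d,ij}$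 for all $d\in\{1,\dots,D-1\}$, $i\in\mathcal P_d$, $j\in\mathcal C_{d,i}$, with given $A_{d,ij}\in\mathbb R^{s_{d,ij}\times n_{d,i}}$, $B_{d,ij}\in\mathbb R^{s_{d,ij}\times n_{d+1,j}}$, $c_{d,ij}\in\mathbb R^{s_{d,ij}}$. **Layered form.** $x_d\in\mathbb R^{n_d}$ stacks all $x_{d,i}$, $i\in\mathcal P_d$, followed by all $x_{d,i}$, $i\in\mathcal L_d$; $f_d(x_d)=\sum_{i\in\mathcal P_d\cup\mathcal L_d}f_{d,i}(x_{d,i})$. For $i\in\mathcal P_d$, $A_{d,i}$ is the vertical stack of $A_{d,ij}$, $j\in\mathcal C_{d,i}$; $B_{d,i}$ is the block-diagonal matrix of $B_{d,ij}$, $j\in\mathcal C_{d,i}$; $c_{d,i}$ is the stack of $c_{d,ij}$. Then $A_d=[\mathrm{blockdiag}(A_{d,i})_{i\in\mathcal P_d},\ 0]\in\mathbb R^{s_d\times n_d}$, $B_d=\mathrm{blockdiag}(B_{d,i})_{i\in\mathcal P_d}M_d\in\mathbb R^{s_d\times n_{d+1}}$, $c_d$ is the stack of $c_{d,i}$, $i\in\mathcal P_d$, where $s_d=\sum_{i\in\mathcal P_d}\sum_{j\in\mathcal C_{d,i}}s_{d,ij}$ and $M_d$ is the permutation matrix with $[[x_{d+1,j}]_{j\in\mathcal C_{d,i}}]_{i\in\mathcal P_d}=M_dx_{d+1}$. The tree problem is exactly the layered problem in the claim. **hADMM.** The augmented Lagrangian is $$L(x_1,\dots,x_D;y_1,\dots,y_{D-1})=f_D(x_D)+\sum_{d=1}^{D-1}\Big(f_d(x_d)+y_d^\top(A_dx_d+B_dx_{d+1}-c_d)+\tfrac{\rho}{2}\|A_dx_d+B_dx_{d+1}-c_d\|_2^2\Big),$$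 with $y_d\in\mathbb R^{s_d}$. From an arbitrary initial point $([x_d^0]_d,[y_d^0]_d)$, iteration $k$ ($k=0,1,2,\dots$, run without stopping) computes, for $d=1,2,\dots,D$ in this order (forward pass), $$x_d^{k+1}=\arg\min_{x_d}L(x_1^{k+1},\dots,x_{d-1}^{k+1},x_d,x_{d+1}^k,\dots,x_D^k;y_1^k,\dots,y_{D-1}^k),$$ and then (backward pass) $y_d^{k+1}=y_d^k+\rho(A_dx_d^{k+1}+B_dx_{d+1}^{k+1}-c_d)$ for $d=D-1,\dots,1$. (The paper's Algorithm 1 is a distributed implementation of these passes over the tree.) **KKT point.** $([x_d^\star]_{d=1}^D,[y_d^\star]_{d=1}^{D-1})$ is a KKT point if $0\in\partial f_1(x_1^\star)+A_1^\top y_1^\star$; $0\in\partial f_D(x_D^\star)+B_{D-1}^\top y_{D-1}^\star$; $0\in\partial f_d(x_d^\star)+A_d^\top y_d^\star+B_{d-1}^\top y_{d-1}^\star$ for $d=2,\dots,D-1$; and $A_dx_d^\star+B_dx_{d+1}^\star=c_d$ for $d=1,\dots,D-1$. **Matrices $\Xi$ and $\Theta$.** Let $s=\sum_{d=1}^{D-1}s_d$. $\|\cdot\|_2$ of a matrix is the spectral norm; $\succeq$ is the Loewner order on symmetric matrices. $\Theta=\mathrm{diag}\big(\tfrac1\rho I_s,(\rho+\sigma)I_s,0_{s\times s},0_{s\times s}\big)$. $\Xi=\Xi^\top\in\mathbb R^{4s\times4s}$ is a $4\times4$ array of $s\times s$ blocks $\Xi^{(a,b)}$: $$\Xi=\begin{bmatrix}\Xi^{(1,1)}&0&0&(\Xi^{(4,1)})^\top\\0&\Xi^{(2,2)}&0&(\Xi^{(4,2)})^\top\\0&0&\Xi^{(3,3)}&(\Xi^{(4,3)})^\top\\\Xi^{(4,1)}&\Xi^{(4,2)}&\Xi^{(4,3)}&\Xi^{(4,4)}\end{bmatrix}.$$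 Each $s\times s$ block is further partitioned into $(D-1)\times(D-1)$ sub-blocks, sub-block $(i,j)$ having size $s_i\times s_j$; sub-blocks not listed are zero. - $\Xi^{(1,1)}$: block tridiagonal; diagonal sub-block $(1,1)$ is $\frac{2(1-t)}{l_2}B_1B_1^\top$; diagonal sub-block $(i,i)$, $i=2,\dots,D-1$, is $2(1-t)\big(\frac1{l_i}A_iA_i^\top+\frac1{l_{i+1}}B_iB_i^\top\big)$; for $i=1,\dots,D-2$, sub-block $(i,i+1)$ is $\frac{2(1-t)}{l_{i+1}}B_iA_{i+1}^\top$ and sub-block $(i+1,i)$ is $\frac{2(1-t)}{l_{i+1}}A_{i+1}B_i^\top$. - $\Xi^{(2,2)}=\mathrm{blockdiag}\big(\frac{2t\alpha_{d+1}}{\|B_d\|_2^2}I_{s_d}\big)_{d=1,\dots,D-1}$, and $\Xi^{(3,3)}=\rho I_s$. - $\Xi^{(4,1)}$: diagonal sub-block $(1,1)$ is $0$; for $i=1,\dots,D-2$, diagonal sub-block $(i+1,i+1)$ is $-\frac{2(1-t)}{l_{i+1}}A_{i+1}A_{i+1}^\top$ and sub-block $(i+1,i)$ is $-\frac{2(1-t)}{l_{i+1}}A_{i+1}B_i^\top$. - $\Xi^{(4,2)}=-\frac\sigma\rho I_s$, and $\Xi^{(4,3)}=-I_s$. - $\Xi^{(4,4)}=\big(\frac1\rho+\frac\sigma{\rho^2}\big)I_s+\mathrm{blockdiag}\big(0_{s_1\times s_1},\frac{2(1-t)}{l_2}A_2A_2^\top,\dots,\frac{2(1-t)}{l_{D-1}}A_{D-1}A_{D-1}^\top\big)$.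 *)

(* Defs.v *)
From HB Require Import structures.
From mathcomp Require Import all_boot all_order all_algebra.
From mathcomp Require Import all_classical all_reals all_analysis.

Set Implicit Arguments.
Unset Strict Implicit.
Unset Printing Implicit Defensive.

Import Order.TTheory GRing.Theory Num.Theory.
Import numFieldNormedType.Exports.

Local Open Scope classical_set_scope.
Local Open Scope ring_scope.

(* The library norm on matrices is the sup norm, hence [enorm] and [specnorm]. *)

Definition dot (R : realType) (n : nat) (u v : 'cV[R]_n) : R :=
  (u^T *m v) 0 0.

Definition enorm (R : realType) (n : nat) (u : 'cV[R]_n) : R :=
  Num.sqrt (dot u u).

Definition specnorm (R : realType) (m n : nat) (A : 'M[R]_(m, n)) : R :=
  sup [set enorm (A *m u) | u in [set u : 'cV[R]_n | enorm u <= 1]].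

Definition psd (R : realType) (n : nat) (M : 'M[R]_n) : Prop :=
  M^T = M /\ forall v : 'cV[R]_n, 0 <= dot v (M *m v).

Definition grad (R : realType) (n : nat) (f : 'cV[R]_n -> R) (z : 'cV[R]_n) :
    'cV[R]_n :=
  \col_i 'D_(delta_mx i 0) f z.

Definition subdiff (R : realType) (n : nat) (f : 'cV[R]_n -> R)
    (x : 'cV[R]_n) : set 'cV[R]_n :=
  [set g | forall z, f x + dot g (z - x) <= f z].

(* No factor 1/2 in front of the modulus. *)
Definition strongly_convex (R : realType) (n : nat) (f : 'cV[R]_n -> R)
    (a : R) : Prop :=
  forall z z' : 'cV[R]_n,
    dot (grad f z') (z - z') + a * enorm (z - z') ^+ 2 <= f z - f z'.

Definition lipschitz_grad (R : realType) (n : nat) (f : 'cV[R]_n -> R)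
    (l : R) : Prop :=
  forall z z' : 'cV[R]_n, enorm (grad f z - grad f z') <= l * enorm (z - z').

Definition is_argmin (R : realType) (X : Type) (F : X -> R) (a : X) : Prop :=
  forall u, F a <= F u.

(* Rectangular blocks, same convention as the library's [mxdiag]: the
   [conform_mx] is a mere cast, since it is only reached when [i = j]. *)
Definition blockdiag (R : realType) (m : nat) (p q : 'I_m -> nat)
    (F : forall i, 'M[R]_(p i, q i)) : 'M[R]_(\sum_i p i, \sum_i q i) :=
  \mxblock_(i < m, j < m) (if i == j then conform_mx 0 (F i) else 0).

Lemma blockdiag_mul (R : realType) (m : nat) (p q : 'I_m -> nat)
    (F : forall i, 'M[R]_(p i, q i)) (v : forall i, 'cV[R]_(q i)) :
  blockdiag F *m (\mxcol_i v i) = \mxcol_i (F i *m v i).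
Proof.
rewrite /blockdiag mxblockEv mxcol_mul; apply: eq_mxcol => i.
rewrite mul_mxrow_mxcol (bigD1 i) //= eqxx conform_mx_id big1 ?addr0 // => j ji.
by rewrite eq_sym (negbTE ji) mul0mx.
Qed.

(* Levels are numbered from 0 (root) to [tp_depth.-1]; there are no nodes
   beyond, so every node of the last level is a leaf.  The data of the edge
   from [(d, i)] to [(d.+1, j)] are given for all pairs [i], [j], but only those
   with [i = tp_parent j] are ever used. *)
Record tree_problem (R : realType) : Type := TreeProblem {
  tp_depth : nat;
  tp_depth_ge2 : (2 <= tp_depth)%N;
  tp_width : nat -> nat;
  tp_width_root : tp_width 0 = 1%N;
  tp_width_gt0 : forall d, (d < tp_depth)%N -> (0 < tp_width d)%N;
  tp_width_eq0 : forall d, (tp_depth <= d)%N -> tp_width d = 0%N;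
  tp_parent : forall d, 'I_(tp_width d.+1) -> 'I_(tp_width d);
  tp_n : forall d, 'I_(tp_width d) -> nat;
  tp_s : forall d, 'I_(tp_width d) -> 'I_(tp_width d.+1) -> nat;
  tp_f : forall d (i : 'I_(tp_width d)), 'cV[R]_(tp_n i) -> R;
  tp_f_convex : forall d (i : 'I_(tp_width d)),
    @convex_function R 'cV[R]_(tp_n i) setT (@tp_f d i);
  tp_A : forall d (i : 'I_(tp_width d)) (j : 'I_(tp_width d.+1)),
    'M[R]_(tp_s i j, tp_n i);
  tp_B : forall d (i : 'I_(tp_width d)) (j : 'I_(tp_width d.+1)),
    'M[R]_(tp_s i j, tp_n j);
  tp_c : forall d (i : 'I_(tp_width d)) (j : 'I_(tp_width d.+1)),
    'cV[R]_(tp_s i j)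
}.

Record layered_problem (R : realType) : Type := LayeredProblem {
  lp_depth : nat;
  lp_n : nat -> nat;
  lp_s : nat -> nat;
  lp_f : forall d, 'cV[R]_(lp_n d) -> R;
  lp_A : forall d, 'M[R]_(lp_s d, lp_n d);
  lp_B : forall d, 'M[R]_(lp_s d, lp_n d.+1);
  lp_c : forall d, 'cV[R]_(lp_s d)
}.

Section LayeredForm.
Variables (R : realType) (T : tree_problem R).

Definition children d (i : 'I_(tp_width T d)) : {set 'I_(tp_width T d.+1)} :=
  [set j | tp_parent j == i]%SET.

Definition parents d : {set 'I_(tp_width T d)} :=
  [set i | children i != finset.set0]%SET.

Definition leaves d : {set 'I_(tp_width T d)} :=
  [set i | children i == finset.set0]%SET.

(* The sets are enumerated in increasing order by [enum_val]. *)
Definition tree_n d : nat :=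
  (\sum_(a < #|parents d|) tp_n (enum_val a) +
   \sum_(a < #|leaves d|) tp_n (enum_val a))%N.

Definition tree_s_node d (i : 'I_(tp_width T d)) : nat :=
  (\sum_(b < #|children i|) tp_s i (enum_val b))%N.

Definition tree_s d : nat :=
  (\sum_(a < #|parents d|) tree_s_node (enum_val a))%N.

Definition tree_stack d (x : forall i : 'I_(tp_width T d), 'cV[R]_(tp_n i)) :
    'cV[R]_(tree_n d) :=
  col_mx (\mxcol_(a < #|parents d|) x (enum_val a))
         (\mxcol_(a < #|leaves d|) x (enum_val a)).

Definition tree_f d (x : 'cV[R]_(tree_n d)) : R :=
  \sum_(a < #|parents d|) tp_f (submxcol (usubmx x) a) +
  \sum_(a < #|leaves d|) tp_f (submxcol (dsubmx x) a).

Definition tree_A_node d (i : 'I_(tp_width T d)) :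
    'M[R]_(tree_s_node i, tp_n i) :=
  \mxcol_(b < #|children i|) tp_A i (enum_val b).

Definition tree_B_node d (i : 'I_(tp_width T d)) :
    'M[R]_(tree_s_node i, \sum_(b < #|children i|) tp_n (enum_val b)) :=
  blockdiag (fun b => tp_B i (enum_val b)).

Definition tree_c_node d (i : 'I_(tp_width T d)) : 'cV[R]_(tree_s_node i) :=
  \mxcol_(b < #|children i|) tp_c i (enum_val b).

(* Block of the permutation matrix: identity if [j = j'], zero otherwise. *)
Definition perm_block d (j j' : 'I_(tp_width T d)) :
    'M[R]_(tp_n j, tp_n j') :=
  \matrix_(r, c) ((j == j') && (r == c :> nat))%:R.

Definition tree_M d :
    'M[R]_(\sum_(a < #|parents d|)
             \sum_(b < #|children (enum_val a)|) tp_n (enum_val b),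
           tree_n d.+1) :=
  \mxcol_(a < #|parents d|) \mxcol_(b < #|children (enum_val a)|)
    row_mx (\mxrow_(u < #|parents d.+1|) perm_block (enum_val b) (enum_val u))
           (\mxrow_(u < #|leaves d.+1|) perm_block (enum_val b) (enum_val u)).

Definition tree_A d : 'M[R]_(tree_s d, tree_n d) :=
  row_mx (blockdiag (fun a : 'I_#|parents d| => tree_A_node (enum_val a))) 0.

Definition tree_B d : 'M[R]_(tree_s d, tree_n d.+1) :=
  blockdiag (fun a : 'I_#|parents d| => tree_B_node (enum_val a)) *m tree_M d.

Definition tree_c d : 'cV[R]_(tree_s d) :=
  \mxcol_(a < #|parents d|) tree_c_node (enum_val a).

Definition layered_of_tree : layered_problem R :=
  LayeredProblem (tp_depth T) tree_f tree_A tree_B tree_c.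

End LayeredForm.

Section LayeredFormTheory.
Variables (R : realType) (T : tree_problem R).

Lemma perm_block_id d (j : 'I_(tp_width T d)) : perm_block j j = 1%:M.
Proof. by apply/matrixP => r c; rewrite !mxE eqxx. Qed.

Lemma perm_block_neq d (j j' : 'I_(tp_width T d)) :
  j != j' -> perm_block j j' = 0.
Proof. by move=> h; apply/matrixP => r c; rewrite !mxE (negbTE h). Qed.

Lemma sum_perm_block d (S : {set 'I_(tp_width T d)})
    (x : forall i : 'I_(tp_width T d), 'cV[R]_(tp_n i)) j :
  \sum_(u < #|S|) perm_block j (enum_val u) *m x (enum_val u) =
  if j \in S then x j else 0.
Proof.
rewrite -(big_enum_val (A := mem S) (fun i => perm_block j i *m x i)) /=.
case: ifP => jS.
  rewrite (bigD1 j) //= perm_block_id mul1mx big1 ?addr0 // => i /andP[_ ij].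
  by rewrite perm_block_neq ?mul0mx // eq_sym.
rewrite big1 // => i iS; rewrite perm_block_neq ?mul0mx //.
by apply: contraFN jS => /eqP ->.
Qed.

Lemma mem_leaves d (i : 'I_(tp_width T d)) :
  (i \in leaves T d) = (i \notin parents T d).
Proof. by rewrite !inE negbK. Qed.

Lemma tree_M_stack d (x : forall i : 'I_(tp_width T d.+1), 'cV[R]_(tp_n i)) :
  tree_M T d *m tree_stack x =
  \mxcol_(a < #|parents T d|) \mxcol_(b < #|children (enum_val a)|) x (enum_val b).
Proof.
rewrite /tree_M /tree_stack mxcol_mul; apply: eq_mxcol => a.
rewrite mxcol_mul; apply: eq_mxcol => b.
rewrite mul_row_col !mul_mxrow_mxcol !sum_perm_block mem_leaves.
by case: (_ \in _); rewrite ?addr0 ?add0r.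
Qed.

(* The layered cost and constraints are those of the tree. *)
Lemma tree_f_stack d (x : forall i : 'I_(tp_width T d), 'cV[R]_(tp_n i)) :
  tree_f (tree_stack x) = \sum_i tp_f (x i).
Proof.
rewrite /tree_f /tree_stack col_mxKu col_mxKd.
under eq_bigr do rewrite mxcolK.
under [X in _ + X]eq_bigr do rewrite mxcolK.
rewrite -(big_enum_val (A := mem (parents T d)) (fun i => tp_f (x i))).
rewrite -(big_enum_val (A := mem (leaves T d)) (fun i => tp_f (x i))).
rewrite [RHS](bigID (mem (parents T d))) /=; congr (_ + _).
by apply: eq_bigl => i; rewrite mem_leaves.
Qed.

Lemma tree_constraint d (x : forall i : 'I_(tp_width T d), 'cV[R]_(tp_n i))
  (x' : forall i : 'I_(tp_width T d.+1), 'cV[R]_(tp_n i)) :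
  tree_A T d *m tree_stack x + tree_B T d *m tree_stack x' = tree_c T d <->
  forall i (j : 'I_(tp_width T d.+1)), tp_parent j = i ->
    tp_A i j *m x i + tp_B i j *m x' j = tp_c i j.
Proof.
have -> : tree_A T d *m tree_stack x + tree_B T d *m tree_stack x' =
  \mxcol_(a < #|parents T d|) \mxcol_(b < #|children (enum_val a)|)
    (tp_A (enum_val a) (enum_val b) *m x (enum_val a)
     + tp_B (enum_val a) (enum_val b) *m x' (enum_val b)).
  rewrite /tree_A /tree_stack mul_row_col mul0mx addr0 blockdiag_mul.
  rewrite /tree_B -mulmxA tree_M_stack blockdiag_mul -mxcolD.
  apply: eq_mxcol => a; rewrite /tree_A_node mxcol_mul /tree_B_node blockdiag_mul.
  by rewrite -mxcolD.
split.
  rewrite /tree_c => /eq_mxcolP h i j pji.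
  have jC : j \in children i by rewrite inE pji.
  have iP : i \in parents T d by rewrite inE; apply/set0Pn; exists j.
  have [a ea] : exists a : 'I_#|parents T d|, enum_val a = i.
    by exists (enum_rank_in iP i); rewrite enum_rankK_in.
  clear pji; subst i; have /= := h a; rewrite /tree_c_node => /eq_mxcolP h'.
  have [b eb] : exists b : 'I_#|children (enum_val a)|, enum_val b = j.
    by exists (enum_rank_in jC j); rewrite enum_rankK_in.
  by subst j; exact: h' b.
move=> h; apply: eq_mxcol => a; apply: eq_mxcol => b; apply: h.
by have := enum_valP b; rewrite inE => /eqP.
Qed.

End LayeredFormTheory.

Coercion layered_of_tree : tree_problem >-> layered_problem.

Section Layered.
Variables (R : realType) (P : layered_problem R).

Local Notation D := (lp_depth P).
Local Notation A := (lp_A P).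
Local Notation B := (lp_B P).
Local Notation f := (lp_f (l := P)).

(* Only the components at levels [d < D] (resp. [d < D.-1]) are meaningful. *)
Definition primal : Type := forall d, 'cV[R]_(lp_n P d).
Definition dual : Type := forall d, 'cV[R]_(lp_s P d).

Definition residual (x : primal) d : 'cV[R]_(lp_s P d) :=
  A d *m x d + B d *m x d.+1 - lp_c P d.

Definition feasible (x : primal) : Prop :=
  forall d, (d < D.-1)%N -> A d *m x d + B d *m x d.+1 = lp_c P d.

(* The costs are finite everywhere and the constraints are affine equalities:
   the relative interior of the domain is the whole space, and a strictly
   feasible point is a point satisfying the constraints. *)
Definition slater : Prop := exists x : primal, feasible x.

Definition objective (x : primal) : R := \sum_(d < D) f (x d).

Definition optimal (x : primal) : Prop :=
  feasible x /\ forall x' : primal, feasible x' -> objective x <= objective x'.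

Definition kkt_point (x : primal) (y : dual) : Prop :=
  (exists2 g, subdiff (@lp_f _ P 0) (x 0%N) g & g + (A 0)^T *m y 0%N = 0) /\
  (forall d, d.+1 = D.-1 ->
     exists2 g, subdiff (@lp_f _ P d.+1) (x d.+1) g &
       g + (B d)^T *m y d = 0) /\
  (forall d, (d.+1 < D.-1)%N ->
     exists2 g, subdiff (@lp_f _ P d.+1) (x d.+1) g &
       g + (A d.+1)^T *m y d.+1 + (B d)^T *m y d = 0) /\
  feasible x.

Definition aug_lagrangian (rho : R) (x : primal) (y : dual) : R :=
  f (x D.-1) +
  \sum_(d < D.-1) (f (x d) + dot (y d) (residual x d)
                   + rho / 2 * enorm (residual x d) ^+ 2).

Definition hadmm (rho : R) (x : nat -> primal) (y : nat -> dual) : Prop :=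
  forall k,
    (forall d, (d < D)%N ->
       is_argmin
         (fun u : 'cV[R]_(lp_n P d) =>
            aug_lagrangian rho
              (dfwith (fun e => if (e < d)%N then x k.+1 e else x k e) d u)
              (y k))
         (x k.+1 d)) /\
    (forall d, (d < D.-1)%N ->
       y k.+1 d = y k d + rho *: residual (x k.+1) d).

Section SDP.
Variables (rho sigma t : R) (alpha l : nat -> R).

Definition lp_stot : nat := (\sum_(d < D.-1) lp_s P d)%N.

(* In the non-diagonal sub-blocks, [conform_mx] is only a cast along the
   equality of indices that has just been tested. *)

Definition Xi11_diag (i : nat) : 'M[R]_(lp_s P i) :=
  (2 * (1 - t)) *:
    ((if i == 0%N then 0 else (l i)^-1 *: (A i *m (A i)^T))
     + (l i.+1)^-1 *: (B i *m (B i)^T)).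

Definition Xi11_up (i : nat) : 'M[R]_(lp_s P i, lp_s P i.+1) :=
  (2 * (1 - t) / l i.+1) *: (B i *m (A i.+1)^T).

Definition Xi11_low (i : nat) : 'M[R]_(lp_s P i.+1, lp_s P i) :=
  (2 * (1 - t) / l i.+1) *: (A i.+1 *m (B i)^T).

Definition Xi11 : 'M[R]_lp_stot :=
  \mxblock_(i < D.-1, j < D.-1)
    (if j == i :> nat then conform_mx 0 (Xi11_diag i)
     else if j == i.+1 :> nat then conform_mx 0 (Xi11_up i)
     else if i == j.+1 :> nat then conform_mx 0 (Xi11_low j)
     else 0).

Definition Xi22 : 'M[R]_lp_stot :=
  \mxdiag_(d < D.-1) (2 * t * alpha d.+1 / specnorm (B d) ^+ 2)%:M.

Definition Xi33 : 'M[R]_lp_stot := rho%:M.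

Definition AAt (i : nat) : 'M[R]_(lp_s P i) :=
  if i == 0%N then 0 else (2 * (1 - t) / l i) *: (A i *m (A i)^T).

Definition Xi41 : 'M[R]_lp_stot :=
  \mxblock_(i < D.-1, j < D.-1)
    (if j == i :> nat then conform_mx 0 (- AAt i)
     else if i == j.+1 :> nat then conform_mx 0 (- Xi11_low j)
     else 0).

Definition Xi42 : 'M[R]_lp_stot := (- (sigma / rho))%:M.

Definition Xi43 : 'M[R]_lp_stot := (- 1)%:M.

Definition Xi44 : 'M[R]_lp_stot :=
  (rho^-1 + sigma / rho ^+ 2)%:M + \mxdiag_(i < D.-1) AAt i.

Definition Xi : 'M[R]_(lp_stot + lp_stot + (lp_stot + lp_stot)) :=
  block_mx (block_mx Xi11 0 0 Xi22) (block_mx 0 Xi41^T 0 Xi42^T)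
           (block_mx 0 0 Xi41 Xi42) (block_mx Xi33 Xi43^T Xi43 Xi44).

Definition Theta : 'M[R]_(lp_stot + lp_stot + (lp_stot + lp_stot)) :=
  block_mx (block_mx (rho^-1)%:M 0 0 (rho + sigma)%:M) 0 0 0.

Definition sdp_set : set R :=
  [set gamma | 0 < gamma /\ psd (Xi - gamma *: Theta)].

(* A supremum, so that attainment is not presupposed. *)
Definition sdp_value : R := sup sdp_set.

Definition sigma_bar : R :=
  let v d := 2 * t * alpha d.+1 / specnorm (B d) ^+ 2 in
  \big[Num.min/v 0%N]_(d < D.-1) v d.

Definition Vhat (x xs : primal) (y ys : dual) : R :=
  \sum_(d < D.-1)
    (rho^-1 * enorm (y d - ys d) ^+ 2
     + (rho + sigma) * enorm (B d *m (x d.+1 - xs d.+1)) ^+ 2).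

End SDP.

End Layered.

(* Main.v *)
Require Import Defs.
From HB Require Import structures.
From mathcomp Require Import all_boot all_order all_algebra.
From mathcomp Require Import all_classical all_reals all_analysis.
From mathcomp Require Import ring lra.

Set Implicit Arguments.
Unset Strict Implicit.
Unset Printing Implicit Defensive.

Import Order.TTheory GRing.Theory Num.Theory.
Import numFieldNormedType.Exports.

Local Open Scope classical_set_scope.
Local Open Scope ring_scope.

(* Write e = x^+ - xs, u = y^+ - ys, w = B e, r = (y^+ - y) / rho (the
   residual) and p = rho B (x^+ - x).  Substituting the dual update into the
   optimality condition of the d-th forward step shows that
   g_d = grad f_d (x_d^+) - grad f_d (xs_d) equals
   - A_d^T (u_d - p_d) - B_{d-1}^T u_{d-1}.  Completing squares turns
   V^k - V^{k+1} into 2 sum_d <g_d, e_d> plus a quadratic form in (w, r, p).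
   For d >= 1 the term 2 <g_d, e_d> is split with weights t and 1 - t and
   bounded below by strong convexity and by Baillon-Haddad cocoercivity; the
   total is at least the form of Xi at (u, w, r, p) plus 2 t times
   sum_d alpha_d |e_d|^2.  Since the form of Theta at this vector is V^{k+1},
   Xi - gamma Theta >= 0 yields the contraction, and the remaining multiple of
   |e_d|^2 bounds the primal error by the square root of V^k. *)

(** * Euclidean inner product, Cauchy-Schwarz inequality and spectral norm *)

Section Euclidean.
Variables (R : realType).
Implicit Types m n : nat.

Lemma dotE n (u v : 'cV[R]_n) : dot u v = \sum_i u i 0 * v i 0.
Proof. by rewrite /dot mxE; apply: eq_bigr => i _; rewrite mxE. Qed.

Lemma dotC n (u v : 'cV[R]_n) : dot u v = dot v u.
Proof. by rewrite !dotE; apply: eq_bigr => i _; rewrite mulrC. Qed.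

Lemma dotDl n (u v w : 'cV[R]_n) : dot (u + v) w = dot u w + dot v w.
Proof. by rewrite /dot linearD mulmxDl mxE. Qed.

Lemma dotDr n (u v w : 'cV[R]_n) : dot w (u + v) = dot w u + dot w v.
Proof. by rewrite /dot mulmxDr mxE. Qed.

Lemma dotZl n a (u w : 'cV[R]_n) : dot (a *: u) w = a * dot u w.
Proof. by rewrite /dot linearZ -scalemxAl mxE. Qed.

Lemma dotZr n a (u w : 'cV[R]_n) : dot w (a *: u) = a * dot w u.
Proof. by rewrite /dot -scalemxAr mxE. Qed.

Lemma dotNl n (u w : 'cV[R]_n) : dot (- u) w = - dot u w.
Proof. by rewrite -scaleN1r dotZl mulN1r. Qed.

Lemma dotNr n (u w : 'cV[R]_n) : dot w (- u) = - dot w u.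
Proof. by rewrite -scaleN1r dotZr mulN1r. Qed.

Lemma dot0l n (w : 'cV[R]_n) : dot 0 w = 0.
Proof. by rewrite -(scale0r 0) dotZl mul0r. Qed.

Lemma dot0r n (w : 'cV[R]_n) : dot w 0 = 0.
Proof. by rewrite dotC dot0l. Qed.

Definition dot_simpl :=
  (dotDl, dotDr, dotNl, dotNr, dotZl, dotZr, dot0l, dot0r).

Lemma dot_mulmxr m n (M : 'M[R]_(m, n)) u v : dot u (M *m v) = dot (M^T *m u) v.
Proof. by rewrite /dot trmx_mul trmxK mulmxA. Qed.

Lemma dot_col_mx m n (u1 v1 : 'cV[R]_m) (u2 v2 : 'cV[R]_n) :
  dot (col_mx u1 u2) (col_mx v1 v2) = dot u1 v1 + dot u2 v2.
Proof. by rewrite /dot tr_col_mx mul_row_col mxE. Qed.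

Lemma dot_trmx m n (M : 'M[R]_(m, n)) u v : dot u (M^T *m v) = dot v (M *m u).
Proof. by rewrite dot_mulmxr trmxK dotC. Qed.

Lemma dotuu_ge0 n (u : 'cV[R]_n) : 0 <= dot u u.
Proof. by rewrite dotE sumr_ge0 // => i _; rewrite -expr2 sqr_ge0. Qed.

Lemma dotuu_eq0 n (u : 'cV[R]_n) : dot u u = 0 -> u = 0.
Proof.
rewrite dotE => /eqP; rewrite psumr_eq0 => [/allP h|i _]; last first.
  by rewrite -expr2 sqr_ge0.
apply/colP => i; rewrite mxE.
by have := h i (mem_index_enum i); rewrite -expr2 sqrf_eq0 => /eqP.
Qed.

Lemma dot_eq0 n (u : 'cV[R]_n) : (forall h, dot u h = 0) -> u = 0.
Proof. by move=> h; exact/dotuu_eq0/h. Qed.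

Lemma enorm_ge0 n (u : 'cV[R]_n) : 0 <= enorm u.
Proof. exact: sqrtr_ge0. Qed.

Lemma enorm_sqr n (u : 'cV[R]_n) : enorm u ^+ 2 = dot u u.
Proof. by rewrite sqr_sqrtr ?dotuu_ge0. Qed.

Lemma enorm_eq0 n (u : 'cV[R]_n) : enorm u = 0 -> u = 0.
Proof. by move=> h; apply: dotuu_eq0; rewrite -enorm_sqr h expr0n. Qed.

Lemma enormZ n a (u : 'cV[R]_n) : enorm (a *: u) = `|a| * enorm u.
Proof.
rewrite /enorm dotZl dotZr mulrA -expr2 sqrtrM ?sqr_ge0 //.
by rewrite sqrtr_sqr.
Qed.

Lemma dot_CauchySchwarz n (u v : 'cV[R]_n) : dot u v ^+ 2 <= dot u u * dot v v.
Proof.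
have [v0|v_gt0] := leP (dot v v) 0.
  have -> : v = 0 by apply: dotuu_eq0; apply/le_anti; rewrite v0 dotuu_ge0.
  by rewrite !dot0r expr0n mulr0.
have := dotuu_ge0 (dot v v *: u - dot u v *: v).
rewrite !dot_simpl (dotC v u) => h.
have {}h : 0 <= dot v v * (dot u u * dot v v - dot u v ^+ 2) by lra.
by rewrite pmulr_rge0 // subr_ge0 in h.
Qed.

Lemma dot_le_enorm n (u v : 'cV[R]_n) : dot u v <= enorm u * enorm v.
Proof.
apply: (le_trans (ler_norm _)).
rewrite -ler_sqr ?nnegrE ?mulr_ge0 ?enorm_ge0 // real_normK ?num_real //.
by rewrite exprMn !enorm_sqr dot_CauchySchwarz.
Qed.

(** The supremum in [specnorm] is an upper bound only if its set is bounded; Cauchy-Schwarz on each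
    row bounds it by the Frobenius norm. *)
Lemma mulmx_enorm_bounded m n (M : 'M[R]_(m, n)) :
  exists C, forall u, enorm u <= 1 -> enorm (M *m u) <= C.
Proof.
exists (Num.sqrt (\sum_i dot (row i M)^T (row i M)^T)) => u u1.
rewrite /enorm ler_wsqrtr // (dotE (M *m u)) ler_sum // => i _.
have -> : (M *m u) i 0 = dot (row i M)^T u.
  by rewrite dotE mxE; apply: eq_bigr => j _; rewrite !mxE.
rewrite -expr2; apply: (le_trans (dot_CauchySchwarz _ _)).
rewrite ler_piMr ?dotuu_ge0 // -enorm_sqr -(expr1n _ 2) ler_sqr ?nnegrE //.
exact: enorm_ge0.
Qed.

Lemma enorm_mulmx_le m n (M : 'M[R]_(m, n)) u :
  enorm (M *m u) <= specnorm M * enorm u.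
Proof.
have [->|u0] := eqVneq u 0.
  by rewrite mulmx0 /enorm !dot0l sqrtr0 mulr0.
have u_gt0 : 0 < enorm u.
  rewrite lt_neqAle enorm_ge0 andbT eq_sym.
  by apply: contra_neq u0; exact: enorm_eq0.
rewrite -ler_pdivrMr // mulrC -[_^-1]ger0_norm ?invr_ge0 ?enorm_ge0 //.
rewrite -enormZ scalemxAr; apply: ub_le_sup.
  have [C hC] := mulmx_enorm_bounded M.
  by exists C => _ [v /= v1 <-]; exact: hC.
exists ((enorm u)^-1 *: u) => //=.
by rewrite enormZ ger0_norm ?invr_ge0 ?enorm_ge0 // mulVf ?gt_eqF.
Qed.

(** Rules out a domain of dimension zero, where a Lipschitz constant could have any sign. *)
Lemma specnorm_neq0 m n (M : 'M[R]_(m, n)) :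
  specnorm M != 0 -> exists u : 'cV[R]_n, u != 0.
Proof.
move=> M0; apply/not_existsP => h; move/eqP: M0; apply.
have z (u : 'cV[R]_n) : u = 0.
  by apply/eqP; apply: contraPT (h u) => ->.
rewrite /specnorm [X in sup X](_ : _ = [set 0]) ?sup1 // seteqP; split.
  by move=> _ [u _ <-]; rewrite (z u) mulmx0 /enorm dot0l sqrtr0.
by move=> _ ->; exists 0; rewrite /= ?mulmx0 /enorm ?dot0l sqrtr0.
Qed.

End Euclidean.

(** * Gradients of smooth strongly convex functions *)

Section SmoothConvex.
Variables (R : realType) (n : nat) (f : 'cV[R]_n -> R).
Hypothesis f_diff : forall z : 'cV[R]_n, differentiable f z.

Lemma derive_grad z h : 'D_h f z = dot (grad f z) h.
Proof.
rewrite deriveE // {1}[h]matrix_sum_delta raddf_sum dotE.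
apply: eq_bigr => i _; rewrite big_ord1 [LHS]linearZ /= mxE deriveE //.
by rewrite mulrC.
Qed.

Lemma is_derive_line (z h : 'cV[R]_n) (s : R) :
  is_derive s 1 (fun s : R => f (z + s *: h)) (dot (grad f (z + s *: h)) h).
Proof.
(* The difference quotient of the restriction to the line, taken at [s], is the directional quotient
   of [f] at [z + s *: h]. *)
have E : (fun e : R => e^-1 *: (((fun s : R => f (z + s *: h)) \o shift s) (e *: 1)
                                - f (z + s *: h))) =
  (fun e : R => e^-1 *: ((f \o shift (z + s *: h)) (e *: h) - f (z + s *: h))).
  apply/funext => e /=; do 3 f_equal.
  by rewrite [e *: 1]mulr1 scalerDl addrCA addrA addrC addrA addrAC.
have D := @diff_derivable _ _ _ f (z + s *: h) h (f_diff _).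
split; first by rewrite /derivable E.
by rewrite -derive_grad /derive E.
Qed.

Lemma is_derive_line_quad z h (b c s : R) :
  is_derive s 1 (fun s : R => f (z + s *: h) + s * b + s ^+ 2 * c)
    (dot (grad f (z + s *: h)) h + b + 2 * s * c).
Proof.
have := is_derive_line z h s => d1.
apply: is_deriveD.
  apply: is_deriveD; apply: is_derive_eq.
  by rewrite scaler0 add0r [_ *: _]mulr1.
apply: is_derive_eq.
by rewrite scaler0 ?addr0 ?add0r /GRing.scale/=; ring.
Qed.

(** Fermat's rule on a line: the right-hand side is minimal at [s = 0], where the quadratic term has
    zero derivative. This form covers both a subgradient inequality ([c = 0]) and the augmented
    Lagrangian, which adds a quadratic to [f] along a line. *)
Lemma min_quad_grad z h (b c : R) :
  (forall s : R, f z <= f (z + s *: h) + s * b + s ^+ 2 * c) ->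
  dot (grad f z) h + b = 0.
Proof.
move=> hmin.
pose phi := fun s : R => f (z + s *: h) + s * b + s ^+ 2 * c.
have dphi (s : R) := is_derive_line_quad z h b c s.
have phi0 : is_derive (0 : R) 1 phi 0.
  apply: (@derive1_at_min _ phi (-1) 1) => //.
  - by rewrite in_itv /=; rewrite ltrN10 ltr01.
  - move=> s _; rewrite /phi scale0r addr0 mul0r expr0n mul0r !addr0.
    exact: hmin.
have [_ e1] := dphi 0; have [_ e2] := phi0.
by move: e1; rewrite e2 scale0r addr0 mulr0 mul0r addr0.
Qed.

Lemma subdiff_grad z g : subdiff f z g -> g = grad f z.
Proof.
move=> hg; apply/eqP; rewrite eq_sym -subr_eq0; apply/eqP/dot_eq0 => h.
rewrite dotDl dotNl; apply: (@min_quad_grad _ _ _ 0) => s.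
have := hg (z + s *: h); rewrite (addrC z) addrK dotZr => ?.
by rewrite mulr0 addr0; lra.
Qed.

Variable l : R.
Hypothesis f_lip : lipschitz_grad f l.

(** [psi] is built so that the claim reads [psi 1 <= psi 0]. By Cauchy-Schwarz and the Lipschitz
    bound its derivative is nonpositive on (0, 1), and the mean value theorem concludes. *)
Lemma descent_lemma z h :
  f (z + h) <= f z + dot (grad f z) h + l / 2 * dot h h.
Proof.
pose psi := fun s : R =>
  f (z + s *: h) + s * - dot (grad f z) h + s ^+ 2 * - (l / 2 * dot h h).
pose dpsi := fun s : R =>
  dot (grad f (z + s *: h) - grad f z) h - s * l * dot h h.
have psi' (s : R) : is_derive s 1 psi (dpsi s).
  apply: is_derive_eq; first exact: is_derive_line_quad.
  by rewrite /dpsi dotDl dotNl; field.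
have [|c c01] := @MVT R psi dpsi 0 1 ltr01 (fun s _ => psi' s).
  by apply: derivable_within_continuous => s _; have [] := psi' s.
rewrite subr0 mulr1 /psi scale1r scale0r addr0 => E.
suff : dpsi c <= 0 by rewrite -E; lra.
have /andP[c0 _] : 0 < c < 1 by move: c01; rewrite in_itv.
rewrite subr_le0; apply: (le_trans (dot_le_enorm _ _)).
have := f_lip (z + c *: h) z.
rewrite (addrC z) addrK enormZ gtr0_norm // => hl.
apply: (le_trans (ler_wpM2r (enorm_ge0 _) hl)).
by rewrite -enorm_sqr; lra.
Qed.

Variable a : R.
Hypothesis f_strong : strongly_convex f a.

(** The two strong convexity inequalities, with [z] and [z'] exchanged, are added; the function
    values cancel and the modulus is doubled. *)
Lemma strongly_convex_monotone z z' :
  2 * a * dot (z - z') (z - z') <= dot (grad f z - grad f z') (z - z').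
Proof.
have := f_strong z z'; have := f_strong z' z.
rewrite -(opprB z z') !enorm_sqr !dot_simpl; lra.
Qed.

Hypothesis a_ge0 : 0 <= a.
Hypothesis l_gt0 : 0 < l.

(* Baillon-Haddad: compare the tangent at [z'] with the descent lemma at [z],
   both taken at the gradient step [z - l^-1 (grad f z - grad f z')]. *)
Lemma grad_gap_le z z' (g := grad f z - grad f z') :
  f z' + dot (grad f z') (z - z') + (2 * l)^-1 * dot g g <= f z.
Proof.
have hd := descent_lemma z (- (l^-1 *: g)).
have hs := f_strong (z - l^-1 *: g) z'.
have : 0 <= a * enorm (z - l^-1 *: g - z') ^+ 2 by rewrite mulr_ge0 // sqr_ge0.
move: hd hs; rewrite (addrAC z _ (- z')) (dotDr (z - z')).
rewrite !dotNr !dotNl !dotZl !dotZr.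
rewrite opprK [l^-1 * (l^-1 * _)]mulrA.
have -> : l / 2 * (l^-1 * l^-1 * dot g g) = l^-1 * dot g g / 2.
  by field; rewrite gt_eqF.
have -> : (2 * l)^-1 * dot g g = l^-1 * dot g g / 2 by field; rewrite gt_eqF.
have -> : l^-1 * dot g g = l^-1 * dot (grad f z) g - l^-1 * dot (grad f z') g.
  by rewrite -mulrBr -[X in _ = l^-1 * (_ + X)]dotNl -dotDl.
lra.
Qed.

(** Adding the gap inequality to its copy with [z] and [z'] exchanged cancels the values of [f] and
    doubles [(2 * l)^-1]. *)
Lemma grad_cocoercive z z' (g := grad f z - grad f z') :
  l^-1 * dot g g <= dot g (z - z').
Proof.
have := grad_gap_le z z'; have := grad_gap_le z' z.
rewrite -(opprB z z') -(opprB (grad f z) (grad f z')) -/g invfM /=.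
rewrite ?dotNr ?dotNl opprK.
have E : dot g (z - z') = dot (grad f z) (z - z') - dot (grad f z') (z - z').
  by rewrite dotDl dotNl.
lra.
Qed.

End SmoothConvex.

(** * Double sums supported on the diagonal or next to it *)

Section IndexSums.
Variable R : realType.

Lemma sum_ord_diag N (F : nat -> R) :
  \sum_(i < N) \sum_(j < N) (if j == i :> nat then F i else 0) =
  \sum_(i < N) F i.
Proof.
by apply: eq_bigr => i _; rewrite -big_mkcond /= (big_pred1 i).
Qed.

Lemma sum_ord_if_succ N (F : nat -> R) :
  \sum_(i < N) (if (i.+1 < N)%N then F i else 0) = \sum_(i < N.-1) F i.
Proof.
case: N => [|N]; first by rewrite !big_ord0.
rewrite big_ord_recr /= ltnn addr0; apply: eq_bigr => i _.
by rewrite ltnS ltn_ord.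
Qed.

Lemma sum_ord_superdiag N (F : nat -> R) :
  \sum_(i < N) \sum_(j < N) (if j == i.+1 :> nat then F i else 0) =
  \sum_(i < N.-1) F i.
Proof.
rewrite -sum_ord_if_succ; apply: eq_bigr => i _; rewrite -big_mkcond /=.
case: ifP => iN; last first.
  by rewrite big_pred0 // => j; apply: contraFF iN => /eqP <-.
by rewrite (big_pred1 (Ordinal iN)).
Qed.

Lemma sum_ord_subdiag N (F : nat -> R) :
  \sum_(i < N) \sum_(j < N) (if i == j.+1 :> nat then F j else 0) =
  \sum_(i < N.-1) F i.
Proof. by rewrite exchange_big sum_ord_superdiag. Qed.

Lemma sum_ord_behead N (F : nat -> R) :
  F 0%N = 0 -> \sum_(i < N) F i = \sum_(i < N.-1) F i.+1.
Proof.
by case: N => [|N] F0; rewrite ?big_ord0 // big_ord_recl F0 add0r.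
Qed.

End IndexSums.

(** * The quadratic forms of [Xi] and [Theta] on stacked dual families *)

Section XiForm.
Variables (R : realType) (P : layered_problem R).
Variables (rho sigma t : R) (alpha l : nat -> R).
Local Notation N := (lp_depth P).-1.
Local Notation A := (lp_A P).
Local Notation B := (lp_B P).
Implicit Types a b u w r p z : dual P.

Definition dual_stack a : 'cV[R]_(lp_stot P) := \mxcol_(d < N) a d.

Lemma dot_dual_stack a b :
  dot (dual_stack a) (dual_stack b) = \sum_(d < N) dot (a d) (b d).
Proof.
by rewrite /dot /dual_stack tr_mxcol mul_mxrow_mxcol summxE.
Qed.

Lemma dot_mxblock_stack (M : forall i j : 'I_N, 'M[R]_(lp_s P i, lp_s P j)) a b :
  dot (dual_stack a) (\mxblock_(i, j) M i j *m dual_stack b) =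
  \sum_(i < N) \sum_(j < N) dot (a i) (M i j *m b j).
Proof.
rewrite mul_mxblock_mxrow /dot /dual_stack tr_mxcol mul_mxrow_mxcol summxE.
by apply: eq_bigr => i _; rewrite mulmx_sumr summxE.
Qed.

Lemma dot_mxdiag_stack (M : forall i : 'I_N, 'M[R]_(lp_s P i)) a b :
  dot (dual_stack a) (\mxdiag_i M i *m dual_stack b) =
  \sum_(i < N) dot (a i) (M i *m b i).
Proof.
by rewrite mul_mxdiag_mxcol /dot /dual_stack tr_mxcol mul_mxrow_mxcol summxE.
Qed.

Local Notation c i := (2 * (1 - t) / l i).

(** The two equal sums at the end come from the superdiagonal and the subdiagonal blocks; the same
    grouping recurs in [sum_dot_adj_sqr]. *)
Lemma dot_Xi11 u :
  dot (dual_stack u) (Xi11 P t l *m dual_stack u) =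
  \sum_(i < N.-1) c i.+1 * dot ((A i.+1)^T *m u i.+1) ((A i.+1)^T *m u i.+1)
  + \sum_(i < N) c i.+1 * dot ((B i)^T *m u i) ((B i)^T *m u i)
  + (\sum_(i < N.-1) c i.+1 * dot ((A i.+1)^T *m u i.+1) ((B i)^T *m u i)
     + \sum_(i < N.-1) c i.+1 * dot ((A i.+1)^T *m u i.+1) ((B i)^T *m u i)).
Proof.
pose F i := c i.+1 * dot ((A i.+1)^T *m u i.+1) ((B i)^T *m u i).
(* [FA] vanishes at the root, as in [Xi11_diag], so its sum can be reindexed by the successor. *)
pose FA i := if i == 0%N then 0 else c i * dot ((A i)^T *m u i) ((A i)^T *m u i).
pose FB i := c i.+1 * dot ((B i)^T *m u i) ((B i)^T *m u i).
rewrite -(@sum_ord_behead _ N FA) // -big_split /=.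
rewrite -[X in _ = X + _](sum_ord_diag _ (fun i => FA i + FB i)).
rewrite -[X in _ = _ + (X + _)](sum_ord_superdiag _ F).
rewrite -[X in _ = _ + (_ + X)](sum_ord_subdiag _ F).
rewrite dot_mxblock_stack -!big_split /=; apply: eq_bigr => i _.
rewrite -!big_split /=; apply: eq_bigr => j _.
(* With plain naturals an equality of indices can be substituted, after which [conform_mx] is the
   identity. *)
move: (nat_of_ord i) (nat_of_ord j) => {}i {}j.
have [->|ji] := eqVneq j i.
  rewrite eqn_leq ltnn andbF !addr0 conform_mx_id /Xi11_diag -scalemxAl dotZr.
  rewrite mulmxDl dotDr mulrDr /FA /FB; congr (_ + _).
    case: ifP => _; first by rewrite mul0mx dot0r mulr0.
    by rewrite -scalemxAl dotZr -mulmxA dot_mulmxr mulrA.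
  by rewrite -scalemxAl dotZr -mulmxA dot_mulmxr mulrA.
have [->|ji'] := eqVneq j i.+1.
  rewrite conform_mx_id ltn_eqF ?ltnS ?leqnSn // add0r addr0 /Xi11_up /F.
  by rewrite -scalemxAl dotZr -mulmxA dot_mulmxr dotC.
have [->|ij] := eqVneq i j.+1.
  by rewrite conform_mx_id !add0r /Xi11_low -scalemxAl dotZr -mulmxA dot_mulmxr.
by rewrite mul0mx dot0r !addr0.
Qed.

Lemma dot_AAt i a b :
  dot (a i.+1) (AAt P t l i.+1 *m b i.+1) =
  c i.+1 * dot ((A i.+1)^T *m a i.+1) ((A i.+1)^T *m b i.+1).
Proof. by rewrite /AAt /= -scalemxAl dotZr -mulmxA dot_mulmxr. Qed.

Lemma sum_dot_AAt a b :
  \sum_(i < N) dot (a i) (AAt P t l i *m b i) =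
  \sum_(i < N.-1) c i.+1 * dot ((A i.+1)^T *m a i.+1) ((A i.+1)^T *m b i.+1).
Proof.
rewrite (@sum_ord_behead _ N (fun i => dot (a i) (AAt P t l i *m b i))).
  by apply: eq_bigr => i _; exact: dot_AAt.
by rewrite /AAt eqxx mul0mx dot0r.
Qed.

Lemma dot_Xi41 p u :
  dot (dual_stack p) (Xi41 P t l *m dual_stack u) =
  - \sum_(i < N.-1) c i.+1 * dot ((A i.+1)^T *m p i.+1) ((A i.+1)^T *m u i.+1)
  - \sum_(i < N.-1) c i.+1 * dot ((A i.+1)^T *m p i.+1) ((B i)^T *m u i).
Proof.
pose F i := c i.+1 * dot ((A i.+1)^T *m p i.+1) ((B i)^T *m u i).
rewrite -sum_dot_AAt -(sum_ord_subdiag _ F).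
rewrite -(sum_ord_diag _ (fun i => dot (p i) (AAt P t l i *m u i))).
rewrite dot_mxblock_stack -!sumrN -big_split /=; apply: eq_bigr => i _.
rewrite -!sumrN -big_split /=; apply: eq_bigr => j _.
move: (nat_of_ord i) (nat_of_ord j) => {}i {}j.
have [->|ji] := eqVneq j i.
  by rewrite eqn_leq ltnn andbF conform_mx_id mulNmx dotNr subr0.
have [->|ij] := eqVneq i j.+1.
  rewrite conform_mx_id mulNmx dotNr oppr0 add0r /Xi11_low.
  by rewrite -scalemxAl dotZr -mulmxA dot_mulmxr.
by rewrite mul0mx dot0r subr0 oppr0.
Qed.

(* Two dual families because the optimality conditions of the forward pass
   involve [y^+ - rho B (x^+ - x)] through [A] but [y^+] through [B]. *)
Definition adj z z' d : 'cV[R]_(lp_n P d) :=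
  (match d with 0%N => 0 | e.+1 => (B e)^T *m z' e end)
  + (if (d < N)%N then (A d)^T *m z d else 0).

Lemma adjB z1 z1' z2 z2' d :
  adj (fun e => z1 e - z2 e) (fun e => z1' e - z2' e) d =
  adj z1 z1' d - adj z2 z2' d.
Proof.
rewrite /adj opprD addrACA; congr (_ + _).
  by case: d => [|d]; rewrite ?subr0 // mulmxBr.
by case: ifP; rewrite ?subr0 // mulmxBr.
Qed.

(** [adj] is the transposed constraint operator: moving each transpose across the inner product and
    shifting the [B] terms by one level turns a sum over levels into a sum over constraints. *)
Lemma dot_adj z z' (x : primal P) : (0 < lp_depth P)%N ->
  \sum_(d < lp_depth P) dot (adj z z' d) (x d) =
  \sum_(d < N) (dot (z d) (A d *m x d) + dot (z' d) (B d *m x d.+1)).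
Proof.
move=> D0; under eq_bigr do rewrite dotDl.
rewrite !big_split /= addrC; congr (_ + _).
  rewrite (eq_bigr (fun d : 'I__ => if (d < N)%N then dot (z d) (A d *m x d) else 0)).
    case: (lp_depth P) D0 => // n _ /=.
    by rewrite big_ord_recr /= ltnn addr0; apply: eq_bigr => i _; rewrite ltn_ord.
  by move=> d _; case: ifP => _; rewrite ?dot0l // dot_mulmxr.
case: (lp_depth P) D0 => // n _ /=.
rewrite big_ord_recl /= dot0l add0r; apply: eq_bigr => i _.
by rewrite dot_mulmxr.
Qed.

(** This weighted square is what [Xi11], twice [Xi41] and the [AAt] part of [Xi44] add up to; the
    right-hand side is grouped like the formulas for these blocks. *)
Lemma sum_dot_adj_sqr u p (g := adj (fun e => u e - p e) u) :
  \sum_(d < N) c d.+1 * dot (g d.+1) (g d.+1) =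
  \sum_(i < N.-1) c i.+1 * dot ((A i.+1)^T *m u i.+1) ((A i.+1)^T *m u i.+1)
  + \sum_(i < N) c i.+1 * dot ((B i)^T *m u i) ((B i)^T *m u i)
  + (\sum_(i < N.-1) c i.+1 * dot ((A i.+1)^T *m u i.+1) ((B i)^T *m u i)
     + \sum_(i < N.-1) c i.+1 * dot ((A i.+1)^T *m u i.+1) ((B i)^T *m u i))
  + \sum_(i < N.-1) c i.+1 * dot ((A i.+1)^T *m p i.+1) ((A i.+1)^T *m p i.+1)
  - (\sum_(i < N.-1) c i.+1 * dot ((A i.+1)^T *m p i.+1) ((A i.+1)^T *m u i.+1)
     + \sum_(i < N.-1) c i.+1 * dot ((A i.+1)^T *m p i.+1) ((B i)^T *m u i))
  - (\sum_(i < N.-1) c i.+1 * dot ((A i.+1)^T *m p i.+1) ((A i.+1)^T *m u i.+1)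
     + \sum_(i < N.-1) c i.+1 * dot ((A i.+1)^T *m p i.+1) ((B i)^T *m u i)).
Proof.
pose q i := (A i.+1)^T *m (u i.+1 - p i.+1); pose b i := (B i)^T *m u i.
pose G i := c i.+1 * (dot (q i) (q i) + dot (q i) (b i) + dot (q i) (b i)).
rewrite (addrC (\sum_(i < N.-1) _) (\sum_(i < N) _)) -!addrA -!opprD -!big_split /=.
rewrite -!sumrN -!big_split /=.
transitivity (\sum_(i < N) c i.+1 * dot (b i) (b i) + \sum_(i < N.-1) G i).
  (* [G] is summed over one index less because [adj] has no [A] term at the last level. *)
  rewrite -(sum_ord_if_succ _ G) -big_split /=; apply: eq_bigr => d _.
  rewrite /g /adj /G -/(b d); case: ifP => _; last by rewrite !addr0.
  by rewrite -/(q d) !dotDl !dotDr (dotC (b d) (q d)); ring.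
congr (_ + _); apply: eq_bigr => d _; rewrite /G /q mulmxBr.
rewrite !dotDl !dotDr !dotNl !dotNr -/(b d).
by rewrite (dotC ((A d.+1)^T *m u d.+1) ((A d.+1)^T *m p d.+1)); ring.
Qed.

(* The blocks are meant to be [y^+ - ys], [B (x^+ - xs)], the residual
   [(y^+ - y) / rho] and [rho B (x^+ - x)]. *)
Definition Xi_vec u w r p :
    'cV[R]_(lp_stot P + lp_stot P + (lp_stot P + lp_stot P)) :=
  col_mx (col_mx (dual_stack u) (dual_stack w))
         (col_mx (dual_stack r) (dual_stack p)).

Lemma dot_Theta u w r p :
  dot (Xi_vec u w r p) (Theta P rho sigma *m Xi_vec u w r p) =
  \sum_(d < N) (rho^-1 * dot (u d) (u d) + (rho + sigma) * dot (w d) (w d)).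
Proof.
rewrite /Theta /Xi_vec !(mul_block_col, mul0mx, addr0, add0r) !mul_scalar_mx.
rewrite !dot_col_mx !dot0r addr0 !dotZr !dot_dual_stack !mulr_sumr.
by rewrite -big_split.
Qed.

(** Separates the form into a gradient part, to be paid by cocoercivity, a [B] part, to be paid by
    strong convexity, and a remainder that [Vhat_step] reproduces exactly. *)
Lemma dot_Xi u w r p (g := adj (fun e => u e - p e) u) :
  dot (Xi_vec u w r p) (Xi P rho sigma t alpha l *m Xi_vec u w r p) =
  \sum_(d < N) c d.+1 * dot (g d.+1) (g d.+1)
  + \sum_(d < N) 2 * t * alpha d.+1 / specnorm (B d) ^+ 2 * dot (w d) (w d)
  + \sum_(d < N) (rho * dot (r d) (r d) - 2 * sigma / rho * dot (p d) (w d)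
      - 2 * dot (p d) (r d) + (rho^-1 + sigma / rho ^+ 2) * dot (p d) (p d)).
Proof.
rewrite /Xi /Xi_vec !(mul_block_col, mul0mx, addr0, add0r) !dot_col_mx.
rewrite !add_col_mx !dot_col_mx !(add0r, addr0) !dotDr !dot_trmx.
rewrite dot_Xi11 dot_Xi41 sum_dot_adj_sqr.
have -> : dot (dual_stack w) (Xi22 P t alpha *m dual_stack w) =
    \sum_(d < N) 2 * t * alpha d.+1 / specnorm (B d) ^+ 2 * dot (w d) (w d).
  rewrite /Xi22 dot_mxdiag_stack; apply: eq_bigr => d _.
  by rewrite mul_scalar_mx dotZr.
rewrite /Xi44 mulmxDl dotDr dot_mxdiag_stack sum_dot_AAt.
rewrite /Xi33 /Xi42 /Xi43 !mul_scalar_mx !dotZr !dot_dual_stack.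
under [X in _ = _ + X]eq_bigr do rewrite -!mulNr.
rewrite !big_split /= -!mulr_sumr; ring.
Qed.

End XiForm.

(** * First-order conditions for the forward steps and for KKT points *)

Section Stationarity.
Variables (R : realType) (P : layered_problem R).
Hypothesis D_gt1 : (1 < lp_depth P)%N.
Local Notation D := (lp_depth P).
Local Notation N := (lp_depth P).-1.
Local Notation A := (lp_A P).
Local Notation B := (lp_B P).
Local Notation f d := (@lp_f R P d).
Hypothesis f_diff : forall d, (d < D)%N ->
  forall z : 'cV[R]_(lp_n P d), differentiable (f d) z.

Let D_gt0 : (0 < D)%N. Proof. exact: ltnW. Qed.

Lemma ltn_level d : (d < N)%N -> (d.+1 < D)%N.
Proof. by case: D D_gt0. Qed.

Lemma aug_lagrangianE rho (x : primal P) (y : dual P) :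
  aug_lagrangian rho x y = objective x +
  \sum_(d < N) (dot (y d) (residual x d)
                + rho / 2 * dot (residual x d) (residual x d)).
Proof.
rewrite /aug_lagrangian /objective.
have -> : \sum_(d < D) f d (x d) = \sum_(d < N) f d (x d) + f N (x N).
  by case: D D_gt0 => // n _; rewrite big_ord_recr.
rewrite (addrC _ (f N (x N))) -addrA -big_split /=; congr (_ + _).
by apply: eq_bigr => d _; rewrite enorm_sqr addrA.
Qed.

(** The residual is affine in the primal variable, so apart from the objective the change along a
    line is an exact quadratic polynomial in [s]. *)
Lemma aug_lagrangian_line rho (x w : primal P) (y : dual P) (s : R)
    (v := fun e => A e *m w e + B e *m w e.+1) :
  aug_lagrangian rho (fun e => x e + s *: w e) y - aug_lagrangian rho x y =
  objective (fun e => x e + s *: w e) - objective x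
  + s * \sum_(e < N) dot (y e + rho *: residual x e) (v e)
  + s ^+ 2 * (rho / 2 * \sum_(e < N) dot (v e) (v e)).
Proof.
rewrite !aug_lagrangianE opprD addrACA -[RHS]addrA; congr (_ + _).
rewrite !mulr_sumr -sumrN -!big_split /=; apply: eq_bigr => e _.
have -> : residual (fun e => x e + s *: w e) e = residual x e + s *: v e.
  rewrite /residual /v !mulmxDr -!scalemxAr scalerDr addrACA.
  by rewrite (addrAC _ _ (- lp_c P e)).
move: (residual x e) (v e) => r u.
rewrite !dotDl !dotDr !dotZl !dotZr (dotC u r).
by field.
Qed.

Lemma argmin_stationary rho (x0 : primal P) (y : dual P) d
    (a : 'cV[R]_(lp_n P d)) (z := fun e => y e + rho *: residual (dfwith x0 d a) e) :
  (d < D)%N -> is_argmin (fun u => aug_lagrangian rho (dfwith x0 d u) y) a ->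
  grad (f d) a + adj z z d = 0.
Proof.
move=> dD amin; apply: dot_eq0 => h.
pose x := dfwith x0 d a; pose w : primal P := dfwith (fun e => 0) d h.
have wd : w d = h by rewrite /w dfwithin.
have w0 e : e != d -> w e = 0 by move=> ed; rewrite /w dfwithout // eq_sym.
pose v e := A e *m w e + B e *m w e.+1.
(* Changing level [d] alone is moving along [w], which vanishes at all other levels. *)
have xE s : dfwith x0 d (a + s *: h) = (fun e => x e + s *: w e).
  apply: functional_extensionality_dep => e; have [<-|ed] := eqVneq d e.
    by rewrite wd /x !dfwithin.
  by rewrite w0 1?eq_sym // scaler0 addr0 /x !dfwithout.
have -> : dot (grad (f d) a + adj z z d) h =
    dot (grad (f d) a) h + \sum_(e < N) dot (z e) (v e).
  rewrite dotDl; congr (_ + _); under [RHS]eq_bigr do rewrite dotDr.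
  rewrite -dot_adj // (bigD1 (Ordinal dD)) //= wd big1 ?addr0 // => e ed.
  by rewrite w0 ?dot0r.
apply: (min_quad_grad (f_diff dD) (c := rho / 2 * \sum_(e < N) dot (v e) (v e))).
move=> s; have := amin (a + s *: h); rewrite xE -subr_ge0.
rewrite aug_lagrangian_line.
have -> : objective (fun e => x e + s *: w e) - objective x =
    f d (a + s *: h) - f d a.
  rewrite /objective -sumrB (bigD1 (Ordinal dD)) //= wd /x dfwithin big1 ?addr0 //.
  by move=> e ed; rewrite w0 // scaler0 addr0 subrr.
by rewrite -/x -subr_ge0; lra.
Qed.

(** When level [d] is updated, level [d.+1] still holds the old iterate while the preceding level is
    already new. Hence the multiplier seen through [A] lags behind the new [y] by
    [rho *: (B d *m (x k.+1 d.+1 - x k d.+1))], and the one seen through [B] is exactly the new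
    [y]. *)
Lemma hadmm_stationary rho x y k d : hadmm (P := P) rho x y -> (d < D)%N ->
  grad (f d) (x k.+1 d) +
  adj (fun e => y k.+1 e - rho *: (B e *m (x k.+1 e.+1 - x k e.+1)))
      (y k.+1) d = 0.
Proof.
move=> xy dD; have [xmin ystep] := xy k.
rewrite -[RHS](argmin_stationary dD (xmin d dD)); congr (_ + _).
rewrite /adj; congr (_ + _).
  case: d dD => // d dD; have dN : (d < N)%N by case: D dD.
  rewrite ystep // /residual dfwithin dfwithout ?ltnSn //.
  by rewrite gtn_eqF.
case: ifP => // dN; rewrite ystep // /residual dfwithin dfwithout ?ltn_eqF //.
rewrite ltnNge leqnSn /= -addrA -scalerBr mulmxBr.
congr (_ *m (_ + _ *: _)).
move: (_ *m _) (_ *m _) (_ *m _) => p q r.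
by apply/matrixP => i j; rewrite !mxE; ring.
Qed.

Lemma kkt_stationary xs ys d : kkt_point (P := P) xs ys -> (d < D)%N ->
  grad (f d) (xs d) + adj ys ys d = 0.
Proof.
move=> [k0 [kN [kd _]]] dD.
have N_gt0 : (0 < N)%N by case: D D_gt1 => // -[].
case: d dD => [|d] dD; rewrite /adj.
  have [g /(subdiff_grad (f_diff dD)) <-] := k0.
  by rewrite add0r N_gt0.
have [dN|dN] := ltnP d.+1 N.
  have [g /(subdiff_grad (f_diff dD)) <-] := kd d dN.
  by rewrite -addrA (addrC (_ *m _)).
have [|g /(subdiff_grad (f_diff dD)) <-] := kN d.
  by apply/eqP; rewrite eqn_leq dN andbT; case: D dD.
by rewrite addr0.
Qed.

(** * Optimality and uniqueness of the primal part of a KKT point *)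

Section Optimality.
Variables (alpha : nat -> R) (xs : primal P) (ys : dual P).
Hypothesis alpha_gt0 : forall d, (d < D)%N -> 0 < alpha d.
Hypothesis f_strong : forall d, (d < D)%N -> strongly_convex (f d) (alpha d).
Hypothesis xys_kkt : kkt_point xs ys.

Let xs_feasible : feasible xs. Proof. by case: xys_kkt => _ [_ []]. Qed.

(** Strong convexity at [xs] is summed over the levels. The linear terms cancel: the gradient there
    is minus [adj ys ys], and the difference of two feasible points lies in the kernel of the
    constraints. *)
Lemma kkt_objective_gap x : feasible x ->
  objective xs + \sum_(d < D) alpha d * dot (x d - xs d) (x d - xs d)
    <= objective x.
Proof.
move=> x_feasible; rewrite -subr_ge0 opprD addrA /objective -sumrB -sumrB.
have E : \sum_(d < D) dot (grad (f d) (xs d)) (x d - xs d) = 0.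
  transitivity (- \sum_(d < D) dot (adj ys ys d) (x d - xs d)).
    rewrite -sumrN; apply: eq_bigr => d _; rewrite -dotNl; congr dot.
    by apply/eqP; rewrite -addr_eq0 kkt_stationary.
  rewrite (dot_adj ys ys (fun e => x e - xs e)) // big1 ?oppr0 // => d _.
  rewrite -dotDr !mulmxBr addrACA -opprD x_feasible ?ltn_ord //.
  by rewrite xs_feasible ?ltn_ord // subrr dot0r.
rewrite -[leLHS]E; apply: ler_sum => d _.
have := f_strong (ltn_ord d) (x d) (xs d); rewrite enorm_sqr; lra.
Qed.

Lemma kkt_optimal : optimal xs.
Proof.
split => // x /kkt_objective_gap; apply: le_trans.
rewrite lerDl sumr_ge0 // => d _.
by rewrite mulr_ge0 ?dotuu_ge0 // ltW ?alpha_gt0.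
Qed.

Lemma optimal_unique x : optimal x -> forall d, (d < D)%N -> x d = xs d.
Proof.
move=> [/kkt_objective_gap gap /(_ _ xs_feasible) xmin] d dD.
have terms_ge0 (e : 'I_D) : true -> 0 <= alpha e * dot (x e - xs e) (x e - xs e).
  by move=> _; rewrite mulr_ge0 ?dotuu_ge0 // ltW ?alpha_gt0.
have : \sum_(e < D) alpha e * dot (x e - xs e) (x e - xs e) == 0.
  by rewrite eq_le sumr_ge0 // andbT; lra.
rewrite psumr_eq0 // => /allP /(_ (Ordinal dD) (mem_index_enum _)) /=.
rewrite mulf_eq0 gt_eqF ?alpha_gt0 //= => /eqP /dotuu_eq0 /eqP.
by rewrite subr_eq0 => /eqP.
Qed.

End Optimality.
End Stationarity.

(** * Lower bounds for the monotonicity gap at each level *)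

Section Energy.
Variables (R : realType) (P : layered_problem R).
Variables (rho sigma t : R) (alpha l : nat -> R).
Local Notation D := (lp_depth P).
Local Notation N := (lp_depth P).-1.
Local Notation A := (lp_A P).
Local Notation B := (lp_B P).
Local Notation f d := (@lp_f R P d).
Hypothesis D_gt1 : (1 < D)%N.
Hypothesis rho_gt0 : 0 < rho.
Hypothesis B_neq0 : forall d, (d < N)%N -> specnorm (B d) != 0.
Hypothesis f_diff : forall d, (d < D)%N ->
  forall z : 'cV[R]_(lp_n P d), differentiable (f d) z.
Hypothesis alpha_gt0 : forall d, (d < D)%N -> 0 < alpha d.
Hypothesis f_strong : forall d, (d < D)%N -> strongly_convex (f d) (alpha d).
Hypothesis f_lip : forall d, (0 < d < D)%N -> lipschitz_grad (f d) (l d).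
Hypothesis t_in01 : 0 < t < 1.
Hypothesis sigma_gt0 : 0 < sigma.

Local Notation V := (@Vhat R P rho sigma).

(** At a nonzero [h], provided by [B d] being nonzero, strong monotonicity and the Lipschitz bound
    together force [2 * alpha d.+1 <= l d.+1]. *)
Lemma lipschitz_const_gt0 d : (d < N)%N -> 0 < l d.+1.
Proof.
move=> dN; have dD := ltn_level D_gt1 dN.
have [h h0] := specnorm_neq0 (B_neq0 dN).
have hh : 0 < dot h h.
  rewrite lt_neqAle dotuu_ge0 andbT eq_sym.
  by apply: contra_neq h0; exact: dotuu_eq0.
have := strongly_convex_monotone (f_strong dD) h 0.
have := dot_le_enorm (grad (f d.+1) h - grad (f d.+1) 0) (h - 0).
have := ler_wpM2r (enorm_ge0 (h - 0)) (f_lip (d := d.+1) dD h 0).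
rewrite subr0 -[l _ * _ * _]mulrA -expr2 enorm_sqr => h1 h2 h3.
rewrite -(pmulr_lgt0 _ hh); apply: lt_le_trans (le_trans h3 (le_trans h2 h1)).
by rewrite !mulr_gt0 ?alpha_gt0.
Qed.

(** The root gradient is not assumed Lipschitz, so strong convexity alone is used; its constant 4 is
    weakened to [2 * t] to match the other levels. *)
Lemma root_gap (z z' : 'cV[R]_(lp_n P 0)) :
  2 * t * alpha 0%N * dot (z - z') (z - z')
    <= 2 * dot (grad (f 0%N) z - grad (f 0%N) z') (z - z').
Proof.
have D_gt0 : (0 < D)%N by exact: ltnW.
have := strongly_convex_monotone (f_strong D_gt0) z z'.
have : 0 <= (2 - t) * (alpha 0%N * dot (z - z') (z - z')).
  rewrite mulr_ge0 ?mulr_ge0 ?dotuu_ge0 // ?(ltW (alpha_gt0 _)) //.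
  by have /andP[] := t_in01; lra.
have : 0 <= alpha 0%N * dot (z - z') (z - z').
  by rewrite mulr_ge0 ?dotuu_ge0 // ltW ?alpha_gt0.
lra.
Qed.

(* The factor [t] splits the monotonicity gap between strong convexity, which
   pays for the blocks [Xi22], and cocoercivity, which pays for [Xi11]. *)
Lemma level_gap d (z z' : 'cV[R]_(lp_n P d.+1)) (e := z - z')
    (g := grad (f d.+1) z - grad (f d.+1) z') : (d < N)%N ->
  2 * t * alpha d.+1 * dot e e + 2 * (1 - t) / l d.+1 * dot g g
  + 2 * t * alpha d.+1 / specnorm (B d) ^+ 2 * dot (B d *m e) (B d *m e)
    <= 2 * dot g e.
Proof.
move=> dN; have dD := ltn_level D_gt1 dN.
have /andP[t_gt0 t_lt1] := t_in01.
have a_gt0 := alpha_gt0 dD.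
have := strongly_convex_monotone (f_strong dD) z z'; rewrite -/e -/g => mono.
have := grad_cocoercive (f_diff dD) (f_lip (d := d.+1) dD) (f_strong dD)
  (ltW a_gt0) (lipschitz_const_gt0 dN) z z'; rewrite -/e -/g /= => coco.
have Be : dot (B d *m e) (B d *m e) / specnorm (B d) ^+ 2 <= dot e e.
  rewrite ler_pdivrMr; last by rewrite exprn_even_gt0 //= B_neq0.
  rewrite -!enorm_sqr mulrC -exprMn ler_sqr ?nnegrE ?enorm_ge0 ?enorm_mulmx_le //.
  by rewrite (le_trans (enorm_ge0 _) (enorm_mulmx_le _ _)).
have h1 : 2 * (1 - t) / l d.+1 * dot g g <= 2 * (1 - t) * dot g e.
  by rewrite -mulrA ler_wpM2l // mulr_ge0 //; lra.
have h2 : 2 * t * (2 * alpha d.+1 * dot e e) <= 2 * t * dot g e.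
  by rewrite ler_wpM2l // mulr_ge0 //; lra.
have h3 : 2 * t * alpha d.+1 / specnorm (B d) ^+ 2 * dot (B d *m e) (B d *m e)
    <= 2 * t * alpha d.+1 * dot e e.
  by rewrite -mulrA ler_wpM2l ?mulr_ge0 ?(ltW t_gt0) ?(ltW a_gt0) // mulrC.
lra.
Qed.

Variables (x : nat -> primal P) (y : nat -> dual P) (xs : primal P) (ys : dual P).
Hypothesis xy_hadmm : hadmm rho x y.
Hypothesis xys_kkt : kkt_point xs ys.

Lemma Vhat_ge0 k : 0 <= V (x k) xs (y k) ys.
Proof.
apply: sumr_ge0 => d _; rewrite addr_ge0 // mulr_ge0 ?sqr_ge0 //.
  by rewrite invr_ge0 ltW.
by rewrite addr_ge0 // ltW.
Qed.

(** * Energy balance of a single iteration *)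

Section Step.
Variable k : nat.
Let e : primal P := fun d => x k.+1 d - xs d.
Let u : dual P := fun d => y k.+1 d - ys d.
Let w : dual P := fun d => B d *m e d.+1.
Let r : dual P := residual (x k.+1).
Let p : dual P := fun d => rho *: (B d *m (x k.+1 d.+1 - x k d.+1)).
Let g d := grad (f d) (x k.+1 d) - grad (f d) (xs d).

Lemma step_gradient d : (d < D)%N -> g d = - adj (fun e => u e - p e) u d.
Proof.
move=> dD; have h1 := hadmm_stationary D_gt1 f_diff k xy_hadmm dD.
have h2 := kkt_stationary D_gt1 f_diff xys_kkt dD.
rewrite (_ : (fun e => u e - p e) = fun e => (y k.+1 e - p e) - ys e); last first.
  by apply: functional_extensionality_dep => d'; rewrite /u addrAC.
rewrite adjB opprB addrC /g; move/eqP: h1; rewrite addr_eq0 => /eqP ->.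
by move/eqP: h2; rewrite addr_eq0 => /eqP ->; rewrite opprK addrC.
Qed.

(** An exact identity. Once the old errors are written as [u d - rho *: r d] and
    [w d - rho^-1 *: p d], both sides are combinations of inner products of [u], [w], [r], [p],
    compared level by level. *)
Lemma Vhat_step :
  V (x k) xs (y k) ys - V (x k.+1) xs (y k.+1) ys =
  2 * \sum_(d < D) dot (g d) (e d) +
  \sum_(d < N) (rho * dot (r d) (r d) - 2 * sigma / rho * dot (p d) (w d)
      - 2 * dot (p d) (r d) + (rho^-1 + sigma / rho ^+ 2) * dot (p d) (p d)).
Proof.
(* Feasibility of [xs] gives [A d *m e d = r d - w d], which [dot_adj] pairs with [u d - p d]. *)
have -> : \sum_(d < D) dot (g d) (e d) =
    - \sum_(d < N) (dot (u d - p d) (r d - w d) + dot (u d) (w d)).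
  under eq_bigr do rewrite step_gradient // dotNl.
  rewrite sumrN dot_adj; last exact: ltnW.
  congr (- _); apply: eq_bigr => d _; congr (dot _ _ + _).
  have [_ [_ [_ /(_ d (ltn_ord d)) feas]]] := xys_kkt.
  by rewrite /r /residual -feas /w /e !mulmxBr opprD addrACA addrK.
rewrite /Vhat -sumrB mulrN mulr_sumr -sumrN -big_split /=.
apply: eq_bigr => d _; rewrite !enorm_sqr.
have -> : y k d - ys d = u d - rho *: r d.
  rewrite /u /r; have [_ ->] := xy_hadmm k; last exact: ltn_ord.
  by rewrite addrAC addrK.
have -> : B d *m (x k d.+1 - xs d.+1) = w d - rho^-1 *: p d.
  by rewrite /p scalerA mulVf ?gt_eqF // scale1r -mulmxBr /e opprB [in RHS]addrC subrKA.
rewrite -[y k.+1 d - ys d]/(u d) -[B d *m _]/(w d).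
move: (u d) (w d) (r d) (p d) => ud wd rd pd.
rewrite !dotDl !dotDr !dotNl !dotNr !dotZl !dotZr.
rewrite (dotC rd ud) (dotC pd wd) (dotC pd rd).
by field; rewrite gt_eqF.
Qed.

(** The remainder in [dot_Xi] cancels against the one in [Vhat_step]; what is left is [root_gap]
    plus [level_gap] at each further level. *)
Lemma step_energy :
  \sum_(d < D) 2 * t * alpha d * dot (e d) (e d)
  + dot (Xi_vec u w r p) (Xi P rho sigma t alpha l *m Xi_vec u w r p)
    <= V (x k) xs (y k) ys - V (x k.+1) xs (y k.+1) ys.
Proof.
rewrite Vhat_step dot_Xi addrA lerD2r.
have split_root (F : nat -> R) : \sum_(d < D) F d = F 0%N + \sum_(d < N) F d.+1.
  by case: D D_gt1 => // n _; rewrite big_ord_recl.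
rewrite (split_root (fun d => 2 * t * alpha d * dot (e d) (e d))).
rewrite (split_root (fun d => dot (g d) (e d))).
rewrite [leRHS]mulrDr mulr_sumr -!addrA -!big_split; apply: lerD; first exact: root_gap.
apply: ler_sum => d _; have := level_gap (x k.+1 d.+1) (xs d.+1) (ltn_ord d).
rewrite /= -[grad _ _ - grad _ _]/(g d.+1) -[_ - xs d.+1]/(e d.+1).
by rewrite {1 2}step_gradient ?(ltn_level D_gt1) // dotNl dotNr opprK addrA.
Qed.

(** The squared errors are retained because [Vhat] sees the primal variables only through [B], and
    the root not at all. *)
Lemma step_contraction gamma : sdp_set P rho sigma t alpha l gamma ->
  \sum_(d < D) 2 * t * alpha d * dot (e d) (e d)
  + (1 + gamma) * V (x k.+1) xs (y k.+1) ys <= V (x k) xs (y k) ys.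
Proof.
move=> [gamma_gt0 [_ /(_ (Xi_vec u w r p))]].
rewrite mulmxBl -scalemxAl dotDr dotNr dotZr dot_Theta.
rewrite (_ : \sum_(d < N) _ = V (x k.+1) xs (y k.+1) ys); last first.
  by apply: eq_bigr => d _; rewrite !enorm_sqr.
by have := step_energy; lra.
Qed.

End Step.

(** * Passage to the optimal value and linear convergence of the primal iterates *)

Hypothesis sdp_feasible : sdp_set P rho sigma t alpha l !=set0.
Local Notation gammas := (sdp_value P rho sigma t alpha l).

Lemma sum_alpha_ge0 k :
  0 <= \sum_(d < D) 2 * t * alpha d * dot (x k d - xs d) (x k d - xs d).
Proof.
have /andP[/ltW t_ge0 _] := t_in01.
by apply: sumr_ge0 => d _; rewrite !mulr_ge0 ?dotuu_ge0 // ltW ?alpha_gt0.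
Qed.

(** When the next value of [Vhat] is positive, each feasible [gamma] is at most a fixed ratio minus
    one, hence so is the supremum. *)
Lemma Vhat_contraction k :
  (1 + gammas) * V (x k.+1) xs (y k.+1) ys <= V (x k) xs (y k) ys.
Proof.
have step gamma : sdp_set P rho sigma t alpha l gamma ->
    (1 + gamma) * V (x k.+1) xs (y k.+1) ys <= V (x k) xs (y k) ys.
  by move=> /(step_contraction k); have := sum_alpha_ge0 k.+1; lra.
have := Vhat_ge0 k.+1; rewrite le_eqVlt => /predU1P[<-|V_gt0].
  by rewrite mulr0 Vhat_ge0.
rewrite -ler_pdivlMr // -lerBrDl; apply: ge_sup => // gamma /step.
by rewrite -ler_pdivlMr // -lerBrDl.
Qed.

(* If [sdp_set] is unbounded, the supremum is the junk value 0. *)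
Lemma sdp_value_ge0 : 0 <= gammas.
Proof.
have [hs|/sup_out] := pselect (has_sup (sdp_set P rho sigma t alpha l)); last first.
  by rewrite /sdp_value => ->.
have [gamma gammaP] := sdp_feasible.
have [/ltW gamma_ge0 _] := gammaP.
by apply: le_trans gamma_ge0 _; apply: ub_le_sup => //; case: hs.
Qed.

(** [gamma] is left free so that the estimate applies both to the optimal value and to a feasible
    point of the program. *)
Lemma geometric_error gamma : 0 <= gamma ->
  (forall k, (1 + gamma) * V (x k.+1) xs (y k.+1) ys <= V (x k) xs (y k) ys) ->
  forall d, (d < D)%N -> exists2 C, 0 <= C &
    forall k, enorm (x k.+1 d - xs d) <= C * (1 / Num.sqrt (1 + gamma)) ^+ k.
Proof.
move=> gamma_ge0 contr d dD.
have /andP[t_gt0 _] := t_in01.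
have b_gt0 : 0 < 2 * t * alpha d by rewrite !mulr_gt0 ?alpha_gt0.
have g_gt0 : 0 < 1 + gamma by rewrite ltr_wpDr.
set q := 1 / Num.sqrt (1 + gamma).
have q_ge0 : 0 <= q by rewrite divr_ge0 // sqrtr_ge0.
have q2 : q ^+ 2 = (1 + gamma)^-1.
  by rewrite /q div1r exprVn sqr_sqrtr // ltW.
have Vk k : V (x k) xs (y k) ys <= V (x 0%N) xs (y 0%N) ys * (q ^+ k) ^+ 2.
  elim: k => [|k IH]; first by rewrite expr0 expr1n mulr1.
  rewrite [q ^+ k.+1]exprSr exprMn q2 mulrA ler_pdivlMr // mulrC.
  exact: le_trans (contr k) IH.
(* The constant combines [Vk] with the bound of [2 * t * alpha d] times the squared error at [k.+1]
   by [Vhat] at [k]. *)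
exists (Num.sqrt (V (x 0%N) xs (y 0%N) ys / (2 * t * alpha d))) => [|k].
  exact: sqrtr_ge0.
rewrite -[q ^+ k]ger0_norm ?exprn_ge0 // -sqrtr_sqr -sqrtrM; last first.
  by rewrite divr_ge0 ?Vhat_ge0 // ltW.
rewrite /enorm ler_wsqrtr // mulrAC ler_pdivlMr // mulrC.
apply: le_trans (Vk k).
(* Any feasible value serves here: it only bounds the squared error by [Vhat] at step [k]. *)
have [gamma' gamma'P] := sdp_feasible.
apply: le_trans (step_contraction k gamma'P).
have V_ge0 : 0 <= (1 + gamma') * V (x k.+1) xs (y k.+1) ys.
  by have [? _] := gamma'P; rewrite mulr_ge0 ?Vhat_ge0 // addr_ge0 // ltW.
rewrite (bigD1 (Ordinal dD)) //= -addrA lerDl addr_ge0 //.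
by apply: sumr_ge0 => i _; rewrite !mulr_ge0 ?dotuu_ge0 // ltW ?alpha_gt0.
Qed.

(** The rate of a feasible [gamma] is used because [gamma] is positive, which makes the ratio less
    than 1, whereas [sdp_value] is only known to be nonnegative. *)
Lemma primal_cvg d : (d < D)%N ->
  enorm (x k d - xs d) @[k --> \oo] --> (0 : R).
Proof.
move=> dD; have [gamma gammaP] := sdp_feasible.
have [gamma_gt0 _] := gammaP.
have [|C C_ge0 bnd] := geometric_error (ltW gamma_gt0) _ dD.
  move=> k; have := step_contraction k gammaP.
  by have := sum_alpha_ge0 k.+1; lra.
(* The geometric bound at [k] concerns the iterate [k.+1]. *)
rewrite -cvg_shiftS.
have q_ge0 : 0 <= 1 / Num.sqrt (1 + gamma) by rewrite divr_ge0 // sqrtr_ge0.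
have q_lt1 : `|1 / Num.sqrt (1 + gamma)| < 1.
  rewrite ger0_norm // div1r invf_lt1 ?sqrtr_gt0 ?ltr_wpDr ?(ltW gamma_gt0) //.
  by rewrite -[ltLHS]sqrtr1 ltr_sqrt ?ltrDl // ltr_wpDr ?(ltW gamma_gt0).
apply: (@squeeze_cvgr _ _ _ _ (fun=> 0) (geometric C (1 / Num.sqrt (1 + gamma)))).
- by near=> k; rewrite enorm_ge0 /= bnd.
- exact: cvg_cst.
- exact: cvg_geometric.
Unshelve. all: by end_near.
Qed.

Lemma primal_geometric_rate : exists2 C : R, 0 < C &
  forall k, \sum_(d < D) enorm (x k.+1 d - xs d)
    <= C * (1 / Num.sqrt (1 + gammas)) ^+ k.
Proof.
have err (d : 'I_D) : {C | 0 <= C & forall k,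
    enorm (x k.+1 d - xs d) <= C * (1 / Num.sqrt (1 + gammas)) ^+ k}.
  exact/cid2/(geometric_error sdp_value_ge0 Vhat_contraction (ltn_ord d)).
(* The levelwise constants are only nonnegative; the added 1 makes the total positive. *)
exists (1 + \sum_(d < D) s2val (err d)) => [|k].
  by rewrite ltr_wpDr // sumr_ge0 // => d _; case: (err d).
have q_ge0 : 0 <= (1 / Num.sqrt (1 + gammas)) ^+ k.
  by rewrite exprn_ge0 // divr_ge0 // sqrtr_ge0.
rewrite mulrDl [1 * (_ ^+ _)]mul1r mulr_suml ler_wpDl //; apply: ler_sum => d _.
by case: (err d).
Qed.

End Energy.

Theorem theorem3 (R : realType) (T : tree_problem R) (rho : R)
  (alpha l : nat -> R) (t sigma gammas : R)
  (x : nat -> primal T) (y : nat -> dual T) (xs : primal T) (ys : dual T)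
  (rho_gt0 : 0 < rho)
  (slaterT : slater T)
  (optT : exists x0 : primal T, optimal x0)
  (B_neq0 : forall d, (d < (lp_depth T).-1)%N -> specnorm (lp_B T d) != 0)
  (f_diff : forall d, (d < lp_depth T)%N ->
     forall z : 'cV[R]_(lp_n T d), differentiable (@lp_f R T d) z)
  (alpha_gt0 : forall d, (d < lp_depth T)%N -> 0 < alpha d)
  (f_strong : forall d, (d < lp_depth T)%N ->
     strongly_convex (@lp_f R T d) (alpha d))
  (f_lip : forall d, (0 < d < lp_depth T)%N ->
     lipschitz_grad (@lp_f R T d) (l d))
  (t_in01 : 0 < t < 1)
  (sigma_bnd : 0 < sigma < sigma_bar T t alpha)
  (sdp_feasible : sdp_set T rho sigma t alpha l !=set0)
  (gammasE : gammas = sdp_value T rho sigma t alpha l)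
  (xy_hadmm : hadmm rho x y)
  (xys_kkt : kkt_point xs ys) :
  (forall k : nat,
     (1 + gammas) * Vhat rho sigma (x k.+1) xs (y k.+1) ys
       <= Vhat rho sigma (x k) xs (y k) ys) /\
  (optimal xs /\
   forall x' : primal T, optimal x' ->
     forall d, (d < lp_depth T)%N -> x' d = xs d) /\
  (forall d, (d < lp_depth T)%N ->
     enorm (x k d - xs d) @[k --> \oo] --> (0 : R)) /\
  exists2 C : R, 0 < C &
    forall k : nat,
      \sum_(d < lp_depth T) enorm (x k.+1 d - xs d)
        <= C * (1 / Num.sqrt (1 + gammas)) ^+ k.
Proof.
have D_gt1 : (1 < lp_depth T)%N := tp_depth_ge2 T.
have /andP[sigma_gt0 _] := sigma_bnd.
rewrite gammasE; split; [|split; [split|split]].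
- exact: (Vhat_contraction D_gt1 rho_gt0 B_neq0 f_diff alpha_gt0 f_strong f_lip
    t_in01 sigma_gt0 xy_hadmm xys_kkt sdp_feasible).
- exact: (kkt_optimal D_gt1 f_diff alpha_gt0 f_strong xys_kkt).
- exact: (optimal_unique D_gt1 f_diff alpha_gt0 f_strong xys_kkt).
- exact: (primal_cvg D_gt1 rho_gt0 B_neq0 f_diff alpha_gt0 f_strong f_lip
    t_in01 sigma_gt0 xy_hadmm xys_kkt sdp_feasible).
- exact: (primal_geometric_rate D_gt1 rho_gt0 B_neq0 f_diff alpha_gt0 f_strong
    f_lip t_in01 sigma_gt0 xy_hadmm xys_kkt sdp_feasible).
Qed.
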